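(* Let $Q$ be a quantale and let $\Sigma_Q$ be a class of proper ideals of $Q$. The quantale space $\Sigma_Q$ is sober if and only if, for every ideal $I$ of $Q$ such that $I^{\uparrow}$ is a non-empty irreducible subset of $\Sigma_Q$, $$\bigcap_{J\in\Sigma_Q,\ I\subseteq J} J\ \in\ I^{\uparrow}.$$
   Context: A quantale here means a complete lattice $(Q,\preccurlyeq,\bot,\top)$ with a binary operation $\&$ that is associative, commutative, satisfies $x\&\bigl(\bigvee_{\lambda} y_\lambda\bigr)=\bigvee_\lambda (x\& y_\lambda)$ for all families, and satisfies $x\&\top=x$ for all $x$. An ideal of $Q$ is a nonempty subset $I\subseteq Q$ such that $x,y\in I$ implies $x\vee y\in I$, and $x\in I$, $l\preccurlyeq x$ imply $l\in I$. $\mathcal I_Q$ is the set of all ideals of $Q$. An ideal is proper if $I\neq Q$. For a set $\Sigma_Q$ of proper ideals of $Q$ and $X\subseteq \mathcal I_Q$, put $X^{\uparrow}=\{J\in\Sigma_Q\mid \bigcap X\subseteq J\}$ if $X\neq\emptyset$ and $\emptyset^{\uparrow}=\emptyset$; write $I^{\uparrow}$ for $\{I\}^{\uparrow}=\{J\in\Sigma_Q\mid I\subseteq J\}$. The quantale topology on $\Sigma_Q$ is the topology having the sets $X^{\uparrow}$ ($X\subseteq \mathcal I_Q$) as a subbasis of closed sets; $\Sigma_Q$ with this topology is called a quantale space. A topological space is sober if every non-empty irreducible closed subset is the closure of a unique point. *)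

(* Defs.v *)
From HB Require Import structures.
From mathcomp Require Import all_boot all_order.
From mathcomp Require Import boolp classical_sets functions topology.

Set Implicit Arguments.
Unset Strict Implicit.
Unset Printing Implicit Defensive.

Import Order.TTheory.
Local Open Scope classical_set_scope.
Local Open Scope order_scope.

HB.mixin Record isCompleteLattice (d : Order.disp_t) L of Order.TBLattice d L := {
  lsup : set L -> L;
  linf : set L -> L;
  lsupP : forall A : set L, supremums A (lsup A);
  linfP : forall A : set L, infimums A (linf A)
}.

#[short(type="completeLatticeType")]
HB.structure Definition CompleteLattice (d : Order.disp_t) :=
  { L of Order.TBLattice d L & isCompleteLattice d L }.

(* Commutative and integral, i.e. the top element is the unit. *)
HB.mixin Record isQuantale (d : Order.disp_t) Q of CompleteLattice d Q := {
  qmul : Q -> Q -> Q;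
  qmulA : associative qmul;
  qmulC : commutative qmul;
  qmul_sup : forall (x : Q) (A : set Q),
    qmul x (lsup A) = lsup [set qmul x y | y in A];
  qmulx1 : forall x : Q, qmul x \top = x
}.

#[short(type="quantaleType")]
HB.structure Definition Quantale (d : Order.disp_t) :=
  { Q of CompleteLattice d Q & isQuantale d Q }.

Section Ideals.
Context {d : Order.disp_t} {Q : quantaleType d}.

Definition is_ideal (I : set Q) : Prop :=
  [/\ I !=set0,
      forall x y, I x -> I y -> I (x `|` y) &
      forall x l, I x -> l <= x -> I l].

Definition is_proper_ideal (I : set Q) : Prop := is_ideal I /\ I <> setT.

(* The empty family is a special case: \bigcap over it is setT, and the
   second conjunct alone would give the members of Sigma equal to setT. *)
Definition uparrow (Sigma : set (set Q)) (X : set (set Q)) : set (set Q) :=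
  [set J | [/\ X !=set0, Sigma J & \bigcap_(I in X) I `<=` J]].

Definition uparrow1 (Sigma : set (set Q)) (I : set Q) : set (set Q) :=
  uparrow Sigma [set I].

Definition quantale_space (Sigma : set (set Q)) : Type := set_type Sigma.

HB.instance Definition _ (Sigma : set (set Q)) :=
  Choice.on (quantale_space Sigma).

Definition point_ideal (Sigma : set (set Q)) (P : quantale_space Sigma) :
  set Q := set_val P.

(* isSubBaseTopological takes a subbasis of open sets, whence the complements. *)
HB.instance Definition _ (Sigma : set (set Q)) :=
  isSubBaseTopological.Build (quantale_space Sigma)
    [set X : set (set Q) | X `<=` is_ideal]
    (fun X => ~` (@point_ideal Sigma @^-1` uparrow Sigma X)).

End Ideals.

Section Sobriety.
Context {T : topologicalType}.

(* Nonemptiness is not included; it is required separately where needed. *)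
Definition irreducible_set (A : set T) : Prop :=
  forall F G : set T, closed F -> closed G ->
    A `<=` F `|` G -> A `<=` F \/ A `<=` G.

End Sobriety.

Definition sober_space (T : topologicalType) : Prop :=
  forall C : set T, C !=set0 -> closed C -> irreducible_set C ->
    exists! x : T, C = closure [set x].

(* Main.v *)
Require Import Defs.
From HB Require Import structures.
From mathcomp Require Import all_boot all_order.
From mathcomp Require Import boolp classical_sets functions topology.
Local Open Scope classical_set_scope.
Local Open Scope order_scope.

(* An irreducible set contained in a finite union of closed sets lies in one of
   them, so every irreducible closed set C is an intersection of subbasic closed
   sets X^up.  A set X^up contains C iff \bigcap X is included in the ideal
   I := \bigcap_(J in C) J, whence C = I^up; moreover the closure of a point P is
   P^up.  A generic point of I^up is thus a least element of I^up, which can only be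
   the intersection of its members. *)

(** Induction on [s], splitting off the head with irreducibility. Nonemptiness of [C] serves the
    empty list, since [irreducible_set] also holds of the empty set. *)
Lemma irreducible_set_bigcup (T : topologicalType) (I : choiceType) (C : set T)
    (s : seq I) (F : I -> set T) :
  C !=set0 -> irreducible_set C -> (forall i, i \in s -> closed (F i)) ->
  (forall x, C x -> exists2 i, i \in s & F i x) ->
  exists2 i, i \in s & C `<=` F i.
Proof.
move=> [x0 Cx0] Cirr.
elim: s => [|i s IHs] Fcl Cs; first by have [] := Cs _ Cx0.
have Fs_cl : closed (\bigcup_(j in [set` s]) F j).
  rewrite bigcup_seq; apply: closed_bigsetU => j js.
  by apply: Fcl; rewrite inE js orbT.
have [x Cx|CFi|CFs] := Cirr _ _ (Fcl i (mem_head i s)) Fs_cl.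
- have [j] := Cs x Cx; rewrite inE => /predU1P[-> ?|js Fjx]; first by left.
  by right; exists j.
- by exists i => //; exact: mem_head.
- have [j js Fjx|x Cx|j js CFj] := IHs; last 1 first.
  + by exists j => //; rewrite inE js orbT.
  + by apply: Fcl; rewrite inE js orbT.
  + by have [j js Fjx] := CFs x Cx; exists j.
Qed.

Section IdealLemmas.
Context {d : Order.disp_t} {Q : quantaleType d}.
Implicit Types (I J : set Q) (X : set (set Q)).

Lemma ideal_bot I : is_ideal I -> I \bot.
Proof. by case=> [[x Ix] _]; apply; [exact: Ix|exact: Order.le0x]. Qed.

Lemma is_ideal_bigcap X : X `<=` is_ideal -> is_ideal (\bigcap_(J in X) J).
Proof.
move=> Xid; split.
(* The bottom element lies in every ideal, so even an infinite intersection has a member. *)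
- by exists \bot => J /Xid; exact: ideal_bot.
- move=> x y Ix Iy J XJ; have [_ + _] := Xid J XJ.
  by apply; [exact: Ix|exact: Iy].
- by move=> x l Ix lx J XJ; have [_ _] := Xid J XJ; apply; [exact: Ix|].
Qed.

Lemma uparrow1E (Sigma : set (set Q)) I J :
  uparrow1 Sigma I J <-> Sigma J /\ I `<=` J.
Proof.
rewrite /uparrow1 /uparrow /= bigcap_set1; split=> [[]//|[? ?]].
by split=> //; exists I.
Qed.

End IdealLemmas.

Section QuantaleSpace.
Context {d : Order.disp_t} {Q : quantaleType d} (Sigma : set (set Q))
  (Sigma_ideal : Sigma `<=` is_ideal).
Local Notation space := (quantale_space Sigma).
Local Notation pt := (@point_ideal d Q Sigma).

Lemma Sigma_point (P : space) : Sigma (pt P).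
Proof. exact: set_valP. Qed.

Lemma point_ideal_inj : injective pt.
Proof. exact: val_inj. Qed.

Lemma subbasic_closed (X : set (set Q)) : X `<=` is_ideal ->
  closed (pt @^-1` uparrow Sigma X).
Proof.
move=> Xid; rewrite -openC.
exists [set ~` (pt @^-1` uparrow Sigma X)]; last exact: bigcup_set1.
by move=> _ ->; exact: finI_from1.
Qed.

Lemma uparrow1_closed (I : set Q) : is_ideal I ->
  closed (pt @^-1` uparrow1 Sigma I).
Proof. by move=> Iid; apply: subbasic_closed => _ ->. Qed.

(** The complement of [F] is a union of finite intersections of complements of subbasic sets. The
    family [s] indexes one such intersection containing [P]; taking complements turns it into a
    finite cover of [F] that avoids [P]. *)
Lemma closed_subbasic_cover (F : set space) (P : space) : closed F -> ~ F P ->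
  exists2 s : seq (set (set Q)),
    forall X, X \in s -> X `<=` is_ideal /\ ~ uparrow Sigma X (pt P) &
    forall R, F R -> exists2 X, X \in s & uparrow Sigma X (pt R).
Proof.
rewrite -openC => -[B sB BE] FP.
have BFE (R : space) : (\bigcup_(U in B) U) R = ~ F R := congr1 (@^~ R) BE.
have [U BU UP] : (\bigcup_(U in B) U) P by rewrite BFE.
have [s sD UE] := sB U BU.
exists (finmap.enum_fset s) => [X Xs|R FR].
  split; first by have := sD X Xs; rewrite inE.
  by move: UP; rewrite -UE; apply.
apply: contrapT => nX.
suff : (\bigcup_(U in B) U) R by rewrite BFE.
exists U => //; rewrite -UE => X Xs.
have nXR : ~ uparrow Sigma X (pt R) by move=> XR; apply: nX; exists X.
exact: nXR.
Qed.

Lemma closure_pointE (P : space) :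
  closure [set P] = pt @^-1` uparrow1 Sigma (pt P).
Proof.
have Pid : is_ideal (pt P) by apply: Sigma_ideal; exact: Sigma_point.
apply/seteqP; split.
  rewrite [X in _ `<=` X](closure_id _).1; last exact: uparrow1_closed.
  apply: closureS => _ ->; apply/uparrow1E; split=> //.
  exact: Sigma_point.
move=> R /uparrow1E[_ PR]; apply: contrapT => nR.
have [s sP sF] := closed_subbasic_cover _ R (@closed_closure _ [set P]) nR.
(* Subbasic sets are upward closed in [Sigma]: the one covering [P] also contains the larger [R],
   which the cover was chosen to avoid. *)
have [|X Xs [X0 _ XP]] := sF P; first exact: subset_closure.
have [_] := sP X Xs; apply; split=> //; first exact: Sigma_point.
exact: subset_trans XP PR.
Qed.

Lemma irreducible_closedE (C : set space) :
  C !=set0 -> closed C -> irreducible_set C ->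
  C = pt @^-1` uparrow1 Sigma (\bigcap_(J in pt @` C) J).
Proof.
move=> C0 Ccl Cirr; apply/seteqP; split=> [P CP|P /uparrow1E[_ IP]].
  apply/uparrow1E; split; first exact: Sigma_point.
  by move=> x; apply; exists P.
apply: contrapT => nCP.
have [s sP sF] := closed_subbasic_cover _ P Ccl nCP.
have [X Xs|X Xs CX] := irreducible_set_bigcup _ _ C s
  (fun X => pt @^-1` uparrow Sigma X) C0 Cirr _ sF.
  by apply: subbasic_closed; have [] := sP X Xs.
have [_] := sP X Xs; apply; split.
(* As the empty family has empty [uparrow], a point of [C] forces [X] to be nonempty. *)
- by have [R CR] := C0; have [] := CX R CR.
- exact: Sigma_point.
- move=> x Xx; apply: IP => _ [R CR <-].
  by have [_ _] := CX R CR; apply.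
Qed.

End QuantaleSpace.

Theorem theorem5p5 (d : Order.disp_t) (Q : quantaleType d)
    (Sigma : set (set Q))
    (Sigma_proper : forall J : set Q, Sigma J -> is_proper_ideal J) :
  sober_space (quantale_space Sigma) <->
  (forall I : set Q, is_ideal I ->
     (@point_ideal d Q Sigma @^-1` uparrow1 Sigma I) !=set0 ->
     irreducible_set (@point_ideal d Q Sigma @^-1` uparrow1 Sigma I) ->
     uparrow1 Sigma I (\bigcap_(J in [set J | Sigma J /\ I `<=` J]) J)).
Proof.
have Sigma_ideal : Sigma `<=` is_ideal by move=> J /Sigma_proper[].
split=> [sober I Iid I0 Iirr|meet C C0 Ccl Cirr].
  have [P [IP _]] := sober _ I0 (uparrow1_closed Sigma I Iid) Iirr.
  (* The generic point [P] and [I] lie below the same members of [Sigma]; hence [P] is the least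
     member containing [I]. *)
  have up_P (R : quantale_space Sigma) :
      I `<=` point_ideal R <-> point_ideal P `<=` point_ideal R.
    have [IR PR] : uparrow1 Sigma I (point_ideal R) <->
        uparrow1 Sigma (point_ideal P) (point_ideal R).
      move: IP; rewrite closure_pointE// => /(congr1 (@^~ R)).
      by rewrite /preimage /= => ->.
    have SR := Sigma_point Sigma R.
    split=> sR.
      by have /uparrow1E[] := IR ((uparrow1E _ _ _).2 (conj SR sR)).
    by have /uparrow1E[] := PR ((uparrow1E _ _ _).2 (conj SR sR)).
  have SP := Sigma_point Sigma P.
  have IsubP : I `<=` point_ideal P by apply/up_P.
  suff -> : \bigcap_(J in [set J | Sigma J /\ I `<=` J]) J = point_ideal P.
    by apply/uparrow1E.
  apply/seteqP; split=> [x|x Px J [SJ IJ]]; first by apply.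
  by have /up_P := IJ : I `<=` point_ideal (SigSub (mem_set SJ)); apply.
set I := \bigcap_(J in @point_ideal d Q Sigma @` C) J.
have CE : C = @point_ideal d Q Sigma @^-1` uparrow1 Sigma I.
  exact: irreducible_closedE.
have Iid : is_ideal I.
  apply: is_ideal_bigcap => _ [P _ <-].
  by apply: Sigma_ideal; exact: Sigma_point.
have /uparrow1E[] : uparrow1 Sigma I
    (\bigcap_(J in [set J | Sigma J /\ I `<=` J]) J).
  by apply: meet => //; rewrite -CE.
set K := \bigcap_(J in _) J => SK IK.
(* The hypothesis puts [K] in [Sigma], so [K] is a point. It contains [I] and lies below every
   member of [Sigma] containing [I], which makes it generic. *)
pose P : quantale_space Sigma := SigSub (mem_set SK).
have CP : C = closure [set P].
  rewrite CE closure_pointE//; apply/seteqP.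
  split=> R /uparrow1E[SR sR]; apply/uparrow1E; split=> //.
    by move=> x; apply; split.
  exact: subset_trans IK sR.
exists P; split=> // R; rewrite CP => PR.
(* Uniqueness: points with equal closures contain each other as ideals. *)
have mem_closure (S S' : quantale_space Sigma) :
    closure [set S] = closure [set S'] -> point_ideal S `<=` point_ideal S'.
  move=> SS'; have : closure [set S] S' by rewrite SS'; exact: subset_closure.
  by rewrite closure_pointE// => /uparrow1E[].
by apply: point_ideal_inj; apply/seteqP; split; exact: mem_closure.
Qed.
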